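(* Let $G$ be a plane graph and let $v_1v_2\cdots v_{2n-1}$ be a path on the boundary of its unbounded face, such that $v_2,v_4,\dots,v_{2n-2}$ have degree two in $G$. Then there is a bijection between the set of spanning trees of $G$ rooted at $v_{2n-1}$ which contain the oriented edges $(v_2,v_3),(v_4,v_5),\dots,(v_{2n-2},v_{2n-1})$ and the set of spanning trees of $G$ rooted at $v_1$ which contain the oriented edges $(v_2,v_1),(v_4,v_3),\dots,(v_{2n-2},v_{2n-3})$.
   Context: Graphs have no loops and no multiple edges. A spanning tree of $G$ rooted at a vertex $v$ is a spanning tree $T$ in which every edge is oriented toward $v$ (i.e., along the unique path in $T$ from the edge to $v$); so each vertex other than $v$ has exactly one outgoing edge. $T$ contains the oriented edge $(a,b)$ if $\{a,b\}$ is an edge of $T$ and it is oriented from $a$ to $b$. *)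

(* Defs.v *)
From mathcomp Require Import all_boot all_order all_algebra.
From mathcomp Require Import all_classical all_reals all_analysis.

Set Implicit Arguments.
Unset Strict Implicit.
Unset Printing Implicit Defensive.

Import Order.TTheory GRing.Theory Num.Theory.
Import numFieldNormedType.Exports.

Record sgraph := SGraph {
  vertex :> finType;
  adj : rel vertex;
  adj_sym : symmetric adj;
  adj_irr : irreflexive adj }.

Section Combinatorics.
Local Open Scope set_scope.
Variable G : sgraph.

Definition degree (x : G) : nat := #|adj x|.

Definition edges : {set {set G}} := [set [set x; y] | x in G, y in adj x].

(* [v 1, ..., v m] is a path of G; values of [v] outside 1..m are irrelevant. *)
Definition is_path (v : nat -> G) (m : nat) : Prop :=
  (forall i, 0 < i < m -> adj (v i) (v i.+1)) /\
  (forall i j, 0 < i <= m -> 0 < j <= m -> v i = v j -> i = j).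

Definition tadj (T : {set {set G}}) : rel G :=
  fun x y => (x != y) && ([set x; y] \in T).

Definition acyclic (T : {set {set G}}) : Prop :=
  forall c : seq G, 2 < size c -> ~ ucycle (tadj T) c.

(* A spanning tree is identified with its set of edges. *)
Definition spanning_tree (T : {set {set G}}) : Prop :=
  [/\ T \subset edges, forall x y, connect (tadj T) x y & acyclic T].

(* [{a, b}] is an edge of T, and the path of T from a to r starts with it. *)
Definition oriented_toward (T : {set {set G}}) (r a b : G) : Prop :=
  exists p : seq G,
    [/\ path (tadj T) a (b :: p), uniq [:: a, b & p] & last b p = r].

(* A rooted spanning tree is identified with its set of oriented edges. *)
Definition rooted_spanning_tree (r : G) (D : {set G * G}) : Prop :=
  exists T, spanning_tree T /\
    forall a b, (a, b) \in D <-> oriented_toward T r a b.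

End Combinatorics.

Local Open Scope classical_set_scope.
Local Open Scope ring_scope.

Definition is_arc (R : realType) (C : set (R * R)) (p q : R * R) : Prop :=
  exists f : R -> R * R,
    [/\ {within `[0, 1], continuous f}, {in `[0, 1] &, injective f},
        f 0 = p, f 1 = q & f @` `[0, 1] = C].

(* [curve x y] is the closed arc drawing the edge xy; it is irrelevant when
   x and y are not adjacent. *)
Record plane_graph (R : realType) := PlaneGraph {
  pgraph :> sgraph;
  pos : pgraph -> R * R;
  curve : pgraph -> pgraph -> set (R * R);
  pos_inj : injective pos;
  curve_sym : forall x y, adj x y -> curve x y = curve y x;
  curve_arc : forall x y, adj x y -> is_arc (curve x y) (pos x) (pos y);
  curve_vertex : forall x y z, adj x y -> curve x y (pos z) -> z = x \/ z = y;
  curve_meet : forall x y z t, adj x y -> adj z t ->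
    [set x; y]%SET <> [set z; t]%SET ->
    curve x y `&` curve z t `<=` range pos }.

Section Faces.
Variables (R : realType) (G : plane_graph R).

Definition drawing : set (R * R) :=
  range (@pos R G) `|`
  [set p | exists x y : G, adj x y /\ curve x y p].

Definition is_face (F : set (R * R)) : Prop :=
  exists2 p, (~` drawing) p & F = connected_component (~` drawing) p.

Definition unbounded_face (F : set (R * R)) : Prop :=
  is_face F /\ ~ bounded_set F.

Definition boundary (F : set (R * R)) : set (R * R) := closure F `\` interior F.

Definition path_on_boundary (F : set (R * R)) (v : nat -> G) (m : nat) : Prop :=
  (forall i, (0 < i <= m)%N -> boundary F (pos (v i))) /\
  (forall i, (0 < i < m)%N -> curve (v i) (v i.+1) `<=` boundary F).

End Faces.

(* Main.v *)
(* Put o k = v (2k+1) and e k = v (2k+2). A rooted spanning tree is a function sending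
   every vertex but the root to its parent, so by the matrix-tree theorem for
   digraphs the two sets are counted by determinants of Laplacians in which
   the only arc leaving e k goes to o (k+1), respectively to o k. Seen as bilinear
   forms in (x, y), the first Laplacian turns into the transpose of the second
   under an integral linear change of x and y, up to a summation by parts along
   o 0, ..., o m. Hence the second determinant divides the first; reversing the
   path gives the converse, and both are natural numbers. *)
Require Import Defs.
From mathcomp Require Import all_classical all_reals all_analysis.
From mathcomp Require Import all_boot all_order all_algebra.
From mathcomp Require Import all_fingroup ring zify.

Set Implicit Arguments.
Unset Strict Implicit.
Unset Printing Implicit Defensive.

Import GRing.Theory Num.Theory.

(** * The matrix-tree theorem *)

Section MatrixTree.
Local Open Scope ring_scope.
Variable T : finType.
Implicit Types (w : rel T) (r : T) (f : {ffun T -> T}).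

(** The root is its own parent, so each in-tree is given by exactly one total function; reaching [r]
    from everywhere excludes any other cycle. *)
Definition intree w r f :=
  [&& f r == r, [forall x, (x != r) ==> w x (f x)] & [forall x, fconnect f x r]].

Definition laplacian w (y : T -> int) a : int := \sum_(b | w a b) (y a - y b).

(** Replacing the root's row by a unit vector gives the same determinant as deleting the row and
    column of [r], and keeps [T] as index set. *)
Definition rooted_laplacian w r (y : T -> int) a : int :=
  if a == r then y r else laplacian w y a.

Definition delta (b : T) : T -> int := fun a => (a == b)%:R.

Definition rooted_laplacian_mx w r : 'M[int]_#|T| :=
  \matrix_(i, j) rooted_laplacian w r (delta (enum_val j)) (enum_val i).

Lemma sum_enum_val (F : T -> int) :
  \sum_x F x = \sum_(i < #|T|) F (enum_val i).
Proof.
rewrite (reindex (@enum_val T T)) //=.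
by apply: onW_bij; exists enum_rank; [exact: enum_valK | exact: enum_rankK].
Qed.

Lemma sum_delta z (F : T -> int) : \sum_b delta b z * F b = F z.
Proof.
rewrite (bigD1 z) //= /delta eqxx mul1r big1 ?addr0 // => b bz.
by rewrite eq_sym (negbTE bz) mul0r.
Qed.

Lemma rooted_laplacian_sum w r y a :
  rooted_laplacian w r y a = \sum_b rooted_laplacian w r (delta b) a * y b.
Proof.
rewrite /rooted_laplacian; case: ifP => _; first by rewrite sum_delta.
rewrite /laplacian (eq_bigr (fun b => \sum_c (delta c a - delta c b) * y c)).
  by rewrite exchange_big /=; apply: eq_bigr => c _; rewrite mulr_suml.
move=> b _; rewrite -(sum_delta a y) -(sum_delta b y) -sumrB.
by apply: eq_bigr => c _; rewrite mulrBl.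
Qed.

Lemma det_enum (M : T -> T -> int) :
  \det (\matrix_(i, j < #|T|) M (enum_val i) (enum_val j)) =
  \sum_(s : 'S_(#|T|)) (-1) ^+ s * \prod_x M x (enum_val (s (enum_rank x))).
Proof.
rewrite /determinant; apply: eq_bigr => s _; congr (_ * _).
rewrite (reindex (@enum_rank T)) /=; last first.
  by apply: onW_bij; exists enum_val; [exact: enum_rankK | exact: enum_valK].
by apply: eq_bigr => x _; rewrite mxE enum_rankK.
Qed.

(** Row [x] of the rooted Laplacian when the only arc leaving [x] goes to [y]. *)
Definition arrow r x y z : int := (z == x)%:R - (if x == r then 0 else (z == y)%:R).

(* A permutation with nonzero Leibniz term that moves x must send x to f x, so
   it moves all iterates of x under f, among them the root, whose row is that of
   the identity. *)
Lemma det_arrow_intree r f : f r = r -> [forall x, fconnect f x r] ->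
  \det (\matrix_(i, j < #|T|)
     arrow r (enum_val i) (f (enum_val i)) (enum_val j)) = 1.
Proof.
move=> fr /forallP fconn; rewrite (det_enum (fun x => arrow r x (f x))).
(* The identity contributes 1: a vertex other than [r] fixed by [f] would never reach [r], so every
   diagonal entry is 1. *)
rewrite (bigD1 1%g) //= odd_perm1 expr0 mul1r big1; last first.
  move=> x _; rewrite perm1 enum_rankK /arrow eqxx; case: eqP => [_|xr] //.
  case: eqP => [fx|]; last by rewrite subr0.
  by case: xr; rewrite -(iter_findex (fconn x)); elim: findex => //= n <-.
rewrite big1 ?addr0 // => s s1; apply/eqP; rewrite mulf_eq0 signr_eq0 /=.
set t := fun x => enum_val (s (enum_rank x)).
have t_inj : injective t by move=> x y /enum_val_inj/perm_inj/enum_rank_inj.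
have [x tx] : exists x, t x != x.
  apply/existsP; apply: contra_neqT s1 => /existsPn tid; apply/permP=> i.
  rewrite perm1; apply: enum_val_inj.
  by have /negbNE/eqP := tid (enum_val i); rewrite /t enum_valK.
apply: contraT => /prodf_neq0 ne0.
have moved n : t (iter n f x) != iter n f x.
  elim: n => //= n; set z := iter n f x => tz.
  have := ne0 z isT; rewrite /arrow -/(t z) (negbTE tz) sub0r oppr_eq0.
  case: (z == r); rewrite ?eqxx // pnatr_eq0 eqb0 negbK => /eqP fz.
  by apply: contraNneq tz => tfz; apply/eqP/(etrans fz)/t_inj/(etrans tfz)/esym.
have := ne0 r isT; rewrite /arrow eqxx subr0 pnatr_eq0 eqb0 negbK.
by rewrite -(iter_findex (fconn x)) (negbTE (moved _)).
Qed.

(** The indicator of the vertices that never reach [r] is a nonzero kernel vector: it agrees on [x]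
    and [f x] for [x != r], and vanishes at [r]. *)
Lemma det_arrow_not_intree r f : f r = r -> ~~ [forall x, fconnect f x r] ->
  \det (\matrix_(i, j < #|T|)
     arrow r (enum_val i) (f (enum_val i)) (enum_val j)) = 0.
Proof.
move=> fr /forallPn[x0 x0r]; apply/eqP; rewrite -det_tr; apply/det0P.
exists (\row_j (~~ fconnect f (enum_val j) r)%:R).
  apply/eqP => /rowP/(_ (enum_rank x0)); rewrite !mxE enum_rankK x0r.
  by move/eqP; rewrite oner_eq0.
apply/rowP => i; rewrite !mxE; set x := enum_val i.
transitivity (\sum_z (~~ fconnect f z r)%:R * arrow r x (f x) z).
  rewrite sum_enum_val.
  by apply: eq_bigr => j _; rewrite !mxE.
have pick y (g : T -> int) : \sum_z g z * (z == y)%:R = g y.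
  rewrite (bigD1 y) //= eqxx mulr1 big1 ?addr0 // => z /negbTE ->.
  by rewrite mulr0.
rewrite /arrow; under eq_bigr do rewrite mulrBr.
rewrite sumrB pick; case: eqP => [->|xr].
  by rewrite connect0 big1 ?subr0 // => z _; rewrite mulr0.
rewrite pick.
suff -> : fconnect f x r = fconnect f (f x) r by rewrite subrr.
apply/idP/idP => [/iter_findex|]; last exact/connect_trans/fconnect1.
by case: findex => [/xr|n <-] //; rewrite iterSr fconnect_iter.
Qed.

(** Each row is the sum of the [arrow] rows of its out-neighbours, so multilinearity expands the
    determinant over all choices of one out-neighbour per vertex. A choice contributes 1 if it is an
    in-tree and 0 otherwise. *)
Theorem matrix_tree w r :
  \det (rooted_laplacian_mx w r) = #|[set f | intree w r f]|%:R.
Proof.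
(* The root may choose only itself, which yields the condition [f r = r]. *)
pose step x : pred T := fun y => if x == r then y == r else w x y.
transitivity (\det (\matrix_(i, j < #|T|)
    \sum_(y | step (enum_val i) y) arrow r (enum_val i) y (enum_val j))).
  congr (\det _); apply/matrixP => i j; rewrite !mxE /rooted_laplacian /arrow.
  rewrite /delta; case: (eqVneq (enum_val i) r) => [->|ir].
    by rewrite /step /= eqxx big_pred1_eq subr0 eq_sym.
  rewrite /step /= (negbTE ir); apply: eq_bigr => y _.
  by rewrite ![_ == enum_val j]eq_sym.
rewrite (det_enum (fun x z => \sum_(y | step x y) arrow r x y z)).
under eq_bigr do rewrite bigA_distr_big_dep mulr_sumr.
rewrite exchange_big /=.
under eq_bigr => f _ do rewrite -(det_enum (fun x => arrow r x (f x))).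
rewrite -[in RHS]sum1_card natr_sum big_mkcond [RHS]big_mkcond; apply: eq_bigr => f _.
have fE x : (f x \in step x) = if x == r then f x == r else w x (f x) by [].
have -> : (f \in family step) = (f r == r) && [forall x, (x != r) ==> w x (f x)].
  apply/familyP/andP => [fs|[fr /forallP fs] x]; last first.
    by rewrite fE; have := fs x; case: eqP => [->|].
  split; first by have := fs r; rewrite fE eqxx.
  by apply/forallP => x; apply/implyP => /negbTE xr; have := fs x; rewrite fE xr.
rewrite inE /intree; case: eqP => //= fr; case: forallP => //= _.
case: (boolP [forall x, fconnect f x r]) => conn.
  exact: det_arrow_intree.
exact: det_arrow_not_intree.
Qed.

(** Evaluated at the basis functions [delta], the identity factors the first matrix as an integral
    matrix times the transpose of the second times an integral matrix; determinants then give the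
    divisibility. *)
Lemma intree_card_dvd w1 r1 w2 r2 (S U : (T -> int) -> T -> int) :
  (forall x y, \sum_a x a * rooted_laplacian w1 r1 y a =
               \sum_a S y a * rooted_laplacian w2 r2 (U x) a) ->
  (#|[set f | intree w2 r2 f]| %| #|[set f | intree w1 r1 f]|)%N.
Proof.
move=> SU.
pose Sx := \matrix_(i, j < #|T|) S (delta (enum_val j)) (enum_val i).
pose Ux := \matrix_(i, j < #|T|) U (delta (enum_val i)) (enum_val j).
have : rooted_laplacian_mx w1 r1 = Ux *m (rooted_laplacian_mx w2 r2)^T *m Sx.
  apply/matrixP => i j; rewrite !mxE.
  set x := delta (enum_val i); set y := delta (enum_val j).
  have pick a : rooted_laplacian w1 r1 y a =
      \sum_b delta a b * rooted_laplacian w1 r1 y b.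
    by rewrite -[LHS]sum_delta; apply: eq_bigr => b _; rewrite /delta eq_sym.
  rewrite pick SU sum_enum_val.
  apply: eq_bigr => k _; rewrite !mxE mulrC; congr (_ * _).
  rewrite rooted_laplacian_sum sum_enum_val.
  by apply: eq_bigr => l _; rewrite !mxE mulrC.
move/(congr1 determinant); rewrite !det_mulmx det_tr !matrix_tree mulrAC.
move/(congr1 absz); rewrite abszM !natz !absz_nat => ->.
exact: dvdn_mull.
Qed.
End MatrixTree.

(** * Pinning every second vertex of a path *)

(** For a root outside the [e k], the in-trees of this digraph are those of [adj] that contain every
    arc from [e k] to [t k]. *)
Definition pinned (T : finType) (adj : rel T) m (e t : nat -> T) : rel T :=
  fun a b => adj a b && [forall k : 'I_m, (a == e k) ==> (b == t k)].

Section Zigzag.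
Local Open Scope ring_scope.
Variables (T : finType) (adj : rel T) (m : nat) (o e : nat -> T).
Hypothesis adj_sym : symmetric adj.
Hypothesis e_inj : forall j k, (j < m)%N -> (k < m)%N -> e j = e k -> j = k.
Hypothesis e_neq_o : forall j k, (j < m)%N -> (k <= m)%N -> e j != o k.
Hypothesis o_neqS : forall k, (k < m)%N -> o k != o k.+1.
Hypothesis adj_e : forall k, (k < m)%N ->
  forall b, adj (e k) b = (b == o k) || (b == o k.+1).

Let E a := [exists k : 'I_m, a == e k].

Let E_e (k : 'I_m) : E (e k).
Proof. by apply/existsP; exists k. Qed.

Let E_o k : (k <= m)%N -> E (o k) = false.
Proof.
move=> km; apply/existsP => -[j /eqP oe].
by have := e_neq_o (ltn_ord j) km; rewrite oe eqxx.
Qed.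

Let sum_E (F : T -> int) : \sum_(a | E a) F a = \sum_(k < m) F (e k).
Proof.
rewrite (eq_bigl (mem [set e (nat_of_ord k) | k in 'I_m])) => [|a]; last first.
  apply/existsP/imsetP => [[k /eqP ->]|[k _ ->]]; by exists k.
rewrite big_imset //= => j k _ _ jk; apply: val_inj; exact: e_inj jk.
Qed.

Let eqe (j k : 'I_m) : (e j == e k) = (j == k).
Proof. by apply/eqP/eqP => [/e_inj jk|->//]; apply: val_inj; apply: jk. Qed.

Let sum_delta_e (F : nat -> int) (k : 'I_m) :
  \sum_(j < m) (e k == e j)%:R * F j = F k.
Proof.
rewrite (bigD1 k) //= eqxx mul1r big1 ?addr0 // => j jk.
by rewrite eqe eq_sym (negbTE jk) mul0r.
Qed.

Let sum_delta_0 (F : nat -> int) a : E a = false ->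
  \sum_(j < m) (a == e j)%:R * F j = 0.
Proof.
move=> Ea; rewrite big1 // => j _; case: eqP => [ae|_]; last by rewrite mul0r.
by move: Ea; rewrite ae E_e.
Qed.

(** Isolates the dependence on [t] in the last summand: the double sum is symmetric in [X] and [Y],
    and the rest is local to the two edges at each [e k]. *)
Lemma pinned_form t (X Y : T -> int) :
  (forall k, (k < m)%N -> adj (e k) (t k)) ->
  \sum_a X a * laplacian (pinned adj m e t) Y a =
  \sum_(a | ~~ E a) \sum_(b | ~~ E b && adj a b) X a * (Y a - Y b) +
  \sum_(k < m) (X (o k) * (Y (o k) - Y (e k)) +
     X (o k.+1) * (Y (o k.+1) - Y (e k)) + X (e k) * (Y (e k) - Y (t k))).
Proof.
move=> adj_t; rewrite (bigID E) /= addrC sum_E.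
have -> : \sum_(k < m) X (e k) * laplacian (pinned adj m e t) Y (e k) =
    \sum_(k < m) X (e k) * (Y (e k) - Y (t k)).
  apply: eq_bigr => k _; congr (_ * _); rewrite /laplacian.
  rewrite (big_pred1 (t k)) // => b; rewrite /pinned.
  apply/andP/eqP => [[_ /forallP/(_ k)]|->]; first by rewrite eqxx => /eqP.
  rewrite adj_t //; split=> //; apply/forallP => j; apply/implyP.
  by rewrite eqe => /eqP ->.
have -> : \sum_(a | ~~ E a) X a * laplacian (pinned adj m e t) Y a =
    \sum_(a | ~~ E a) (\sum_(b | ~~ E b && adj a b) X a * (Y a - Y b) +
                       \sum_(b | E b && adj a b) X a * (Y a - Y b)).
  apply: eq_bigr => a Ea; rewrite /laplacian mulr_sumr (bigID E) /= addrC.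
  have pE b : pinned adj m e t a b = adj a b.
    rewrite /pinned; case: forallP => [_|[] k]; first by rewrite andbT.
    by apply/implyP => ae; case/negP: Ea; apply/existsP; exists k.
  by congr (_ + _); apply: eq_bigl => b; rewrite pE andbC.
rewrite big_split /= -addrA; congr (_ + _).
(* Arcs from unpinned to pinned vertices are grouped by their head [e k]; the tails are then [o k]
   and [o k.+1]. *)
rewrite (exchange_big_dep E) /=; last by move=> a b _ /andP[].
rewrite sum_E -big_split /=; apply: eq_bigr => k _; congr (_ + _).
have km := ltn_ord k.
rewrite (eq_bigl (pred2 (o k) (o k.+1))) => [|a]; last first.
  rewrite /= E_e /= adj_sym adj_e //; apply/andb_idl.
  by case/orP => /eqP ->; rewrite E_o // ltnW.
rewrite (bigD1 (o k)) /= ?eqxx //; congr (_ + _).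
rewrite (big_pred1 (o k.+1)) // => a /=.
by case: eqP => //= [->|]; [rewrite (negbTE (o_neqS km)) | rewrite andbT].
Qed.

(* Invariance of the symmetric part under exchanging the two arguments, plus
   summation by parts along [o 0, ..., o m]. *)
Lemma pinned_transpose (X Y : T -> int) : X (o m) = 0 -> Y (o 0%N) = 0 ->
  \sum_a X a * laplacian (pinned adj m e (o \o S)) Y a =
  \sum_a (Y a + \sum_(k < m) (a == e k)%:R * Y (o k)) *
     laplacian (pinned adj m e o)
       (fun b => X b - \sum_(k < m) (b == e k)%:R * X (o k.+1)) a.
Proof.
move=> Xm Y0; rewrite !pinned_form; last first.
- by move=> k km; rewrite adj_e // eqxx orbT.
- by move=> k km; rewrite adj_e // eqxx.
congr (_ + _).
  transitivity (\sum_(a | ~~ E a) \sum_(b | ~~ E b && adj a b) Y a * (X a - X b)).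
    under eq_bigr => a _ do under eq_bigr do rewrite mulrBr.
    under [RHS]eq_bigr => a _ do under eq_bigr do rewrite mulrBr (mulrC (Y a) (X a)).
    under eq_bigr do rewrite sumrB; under [RHS]eq_bigr do rewrite sumrB.
    rewrite !sumrB; congr (_ - _).
    rewrite [RHS](exchange_big_dep (fun b => ~~ E b)) /=; last first.
      by move=> a b _ /andP[].
    apply: eq_bigr => a Ea; apply: eq_big => [b|b _]; last exact: mulrC.
    by rewrite Ea adj_sym.
  apply: eq_bigr => a /negbTE Ea; apply: eq_bigr => b /andP[/negbTE Eb _].
  rewrite !(sum_delta_0 (fun k => Y (o k))) // addr0.
  by rewrite !(sum_delta_0 (fun k => X (o k.+1))) // !subr0.
apply/eqP; rewrite -subr_eq0 -sumrB /=.
(* The local terms of the two sides at [e k] differ by the change of [X * Y] from [o k] to [o k.+1].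
   The sum telescopes to the two ends, where [Xm] and [Y0] make the product vanish. *)
rewrite (eq_bigr (fun k : 'I_m => - (X (o k.+1) * Y (o k.+1) - X (o k) * Y (o k)))).
  rewrite sumrN
    -(big_mkord xpredT (fun k => X (o k.+1) * Y (o k.+1) - X (o k) * Y (o k))).
  by rewrite telescope_sumr // Xm Y0 mul0r mulr0 subrr oppr0.
move=> k _; have km := ltn_ord k.
rewrite (sum_delta_e (fun k => Y (o k))) (sum_delta_e (fun k => X (o k.+1))).
rewrite !(sum_delta_0 (fun k => Y (o k))) ?E_o // ?(ltnW km) //.
rewrite !(sum_delta_0 (fun k => X (o k.+1))) ?E_o // ?(ltnW km) //.
by ring.
Qed.

(** [pinned_transpose] asks for [X] vanishing at [o m] and [Y] vanishing at [o 0]. Laplacians ignore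
    constants, so [y] is shifted by [y s]; [x] is cut off at [r], and its lost coordinate is carried
    by the root rows. *)
Lemma pinned_intree_card_dvd :
  (#|[set f | intree (pinned adj m e o) (o 0%N) f]| %|
   #|[set f | intree (pinned adj m e (o \o S)) (o m) f]|)%N.
Proof.
set r := o m; set s := o 0%N.
pose X0 (x : T -> int) a := if a == r then 0 else x a.
(* At [s] the first map gives [y r], and the constant [x r - X0 x s] makes the second give [x r], so
   each side has the root term [x r * y r]. *)
apply: (@intree_card_dvd _ _ _ _ _
  (fun y a => if a == s then y r else
     y a - y s + \sum_(k < m) (a == e k)%:R * (y (o k) - y s))
  (fun x b => X0 x b - \sum_(k < m) (b == e k)%:R * X0 x (o k.+1) + (x r - X0 x s))).
move=> x y.
have sE : E s = false by rewrite E_o.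
transitivity (x r * y r + \sum_(a | a != s)
    (y a - y s + \sum_(k < m) (a == e k)%:R * (y (o k) - y s)) *
      laplacian (pinned adj m e o)
         (fun b => X0 x b - \sum_(k < m) (b == e k)%:R * X0 x (o k.+1)) a).
  have := @pinned_transpose (X0 x) (fun b => y b - y s).
  rewrite /X0 eqxx subrr => /(_ erefl erefl) tr.
  rewrite [X in _ = _ + X](_ : _ = \sum_a X0 x a *
      laplacian (pinned adj m e (o \o S)) (fun b => y b - y s) a).
    rewrite (bigD1 r) //= /rooted_laplacian eqxx; congr (_ + _).
    rewrite [RHS](bigD1 r) //= /X0 eqxx mul0r add0r; apply: eq_bigr => a /negbTE ar.
    by rewrite ar; congr (_ * _); apply: eq_bigr => b _; ring.
  rewrite [RHS]tr [RHS](bigD1 s) //= subrr add0r.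
  by rewrite (sum_delta_0 (fun k => y (o k) - y s)) // mul0r add0r.
rewrite [RHS](bigD1 s) //= /rooted_laplacian eqxx; congr (_ + _).
  by rewrite (sum_delta_0 (fun k => X0 x (o k.+1))) // mulrC; congr (_ * _); ring.
apply: eq_bigr => a /negbTE ->; congr (_ * _); apply: eq_bigr => b _; ring.
Qed.
End Zigzag.

(** * Rooted spanning trees as parent functions *)

(** The depth is the least number of steps to [r]; it supports the inductions along parents
    below. *)
Lemma fconnect_depth (T : finType) (f : T -> T) r : (forall x, fconnect f x r) ->
  exists d : T -> nat, forall x, x != r -> d (f x) < d x.
Proof.
move=> conn.
have ex x : exists n, iter n f x == r.
  by exists (findex f x r); rewrite iter_findex.
exists (fun x => ex_minn (ex x)) => x xr.
case: (ex_minnP (ex x)) => -[|n] /= fn _; first by rewrite fn in xr.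
case: ex_minnP => n' _ min; apply: min.
by rewrite -iterSr.
Qed.

Lemma depth_fconnect (T : finType) (f : T -> T) r (d : T -> nat) :
  (forall x, x != r -> d (f x) < d x) -> forall x, fconnect f x r.
Proof.
move=> dP x; elim: {x}(d x).+1 {-2}x (ltnSn (d x)) => // n IH x dx.
have [->|xr] := eqVneq x r; first exact: connect0.
apply: connect_trans (fconnect1 f x) (IH _ _).
exact: leq_trans (dP _ xr) dx.
Qed.

Section TreeOfFunction.
Variables (G : sgraph) (r : G).
Implicit Types (f g : {ffun G -> G}) (T : {set {set G}}).

Definition tree_of f : {set {set G}} := [set [set x; f x] | x in [set~ r]].

Definition arcs_of f : {set G * G} := [set (x, f x) | x in [set~ r]].

Lemma arcs_ofE f a b : ((a, b) \in arcs_of f) = (a != r) && (b == f a).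
Proof.
apply/imsetP/andP => [[x]|[ar /eqP ->]].
  by rewrite !inE => xr [-> ->].
by exists a; rewrite ?inE.
Qed.

(** The arcs forget the value at the root, which the two fixed-point hypotheses restore. *)
Lemma arcs_of_inj f g : f r = r -> g r = r -> arcs_of f = arcs_of g -> f = g.
Proof.
move=> fr gr fg; apply/ffunP => x; have [->|xr] := eqVneq x r; first by rewrite fr.
by have := arcs_ofE f x (f x); rewrite fg arcs_ofE xr eqxx => /= /eqP.
Qed.

(** * The spanning tree of a parent function *)

Section Depth.
Variables (f : {ffun G -> G}) (d : G -> nat).
Hypothesis adj_f : forall x, x != r -> adj x (f x).
Hypothesis d_f : forall x, x != r -> d (f x) < d x.

Let neq_f x : x != r -> x != f x.
Proof. by move=> /adj_f; apply: contraTneq => <-; rewrite adj_irr. Qed.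

Lemma tadj_tree_ofP x y :
  reflect (x != r /\ y = f x \/ y != r /\ x = f y) (tadj (tree_of f) x y).
Proof.
apply: (iffP andP) => [[xy /imsetP[z]]|].
  rewrite !inE => zr xyz; have := set21 x y; have := set22 x y.
  rewrite xyz !inE => /orP[] /eqP yE /orP[] /eqP xE; subst x y; auto.
    by rewrite eqxx in xy.
  by rewrite eqxx in xy.
have edge z : z != r -> [set z; f z] \in tree_of f.
  by move=> zr; apply: (imset_f (fun z => [set z; f z])); rewrite !inE.
case=> -[zr ->]; first by rewrite neq_f ?edge.
by rewrite eq_sym neq_f // setUC edge.
Qed.

Lemma tadj_tree_of_f x : x != r -> tadj (tree_of f) x (f x).
Proof. by move=> xr; apply/tadj_tree_ofP; left. Qed.

Lemma connect_tree_of x : connect (tadj (tree_of f)) x r.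
Proof.
elim: {x}(d x).+1 {-2}x (ltnSn (d x)) => // n IH x dx.
have [->|xr] := eqVneq x r; first exact: connect0.
apply: connect_trans (connect1 (tadj_tree_of_f xr)) (IH _ _).
exact: leq_trans (d_f xr) dx.
Qed.

Lemma tadj_sym T : symmetric (@tadj G T).
Proof. by move=> x y; rewrite /tadj eq_sym setUC. Qed.

Lemma connect_tadjC T : connect_sym (@tadj G T).
Proof. exact/sym_connect_sym/tadj_sym. Qed.

(* A vertex of maximal depth on a cycle has both its neighbours equal to its
   parent. *)
Lemma tree_of_acyclic : acyclic (tree_of f).
Proof.
case=> // x0 c0; set c := x0 :: c0 => sz /andP[cyc uc].
case: (@arg_maxnP _ x0 (mem c) d (mem_head _ _)) => x xc max.
have [i p cE] := rot_to xc.
move: cyc uc sz max; rewrite -(rot_cycle i) -(rot_uniq i) -(size_rot i) cE.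
move=> cyc ux sz max.
have {}max y : y \in x :: p -> d y <= d x by rewrite -cE mem_rot; apply: max.
case: p cE cyc ux sz max => [|y q] // _; case/lastP: q => [|q z] //.
rewrite /= rcons_path last_rcons mem_rcons !inE => /and3P[xy _ zx] /and3P[_ yz _] _ max.
have yE : y = f x.
  case/tadj_tree_ofP: xy => -[] // yr xE.
  have := max y; rewrite !inE eqxx orbT => /(_ isT).
  by rewrite leqNgt xE d_f.
have zE : z = f x.
  case/tadj_tree_ofP: zx => -[] // zr xE.
  have := max z; rewrite !inE mem_rcons inE eqxx !orbT => /(_ isT).
  by rewrite leqNgt xE d_f.
by move: yz; rewrite yE zE eqxx.
Qed.

Lemma tree_of_spanning : spanning_tree (tree_of f).
Proof.
split; last exact: tree_of_acyclic.
  apply/subsetP => A /imsetP[x]; rewrite !inE => xr ->.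
  by apply/imset2P; apply: (Imset2spec (x1 := x) (x2 := f x)) => //; exact: adj_f.
move=> x y; apply: connect_trans (connect_tree_of x) _.
by rewrite connect_tadjC connect_tree_of.
Qed.

(** After a step from a parent to a child, going up would revisit the parent, so a simple path keeps
    descending and only meets children. *)
Lemma tree_of_descent x y p : y != r -> x = f y ->
  path (tadj (tree_of f)) y p -> uniq [:: x, y & p] -> last y p != r.
Proof.
elim: p x y => //= z p IH x y yr xE /andP[yz pz] /and3P[].
rewrite !inE !negb_or => /and3P[xy xz xp] /andP[yz' yp] /andP[zp up].
case/tadj_tree_ofP: yz => -[zr zE]; first by rewrite xE zE eqxx in xz.
by apply: (IH y z) => //=; rewrite inE negb_or yz' yp zp.
Qed.

Lemma oriented_tree_of a b :
  oriented_toward (tree_of f) r a b <-> (a, b) \in arcs_of f.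
Proof.
rewrite arcs_ofE; split.
  case=> p [/= /andP[ab pp] up lr].
  case/tadj_tree_ofP: ab => -[]; first by move=> -> ->; rewrite eqxx.
  by move=> br aE; have := tree_of_descent br aE pp up; rewrite lr eqxx.
case/andP=> ar /eqP ->.
elim: {a}(d a).+1 {-2}a (ltnSn (d a)) ar => // n IH a da ar.
(* This is the path of successive parents; the depth bound shows that it is simple and can be
   prefixed by [a]. *)
suff [p [pp up lr pd]] : exists p, [/\ path (tadj (tree_of f)) (f a) p,
    uniq (f a :: p), last (f a) p = r & {in p, forall z, d z < d (f a)}].
  exists p; split=> //; first by rewrite /= tadj_tree_of_f.
  rewrite cons_uniq up andbT inE negb_or neq_f //=.
  by apply/negP => /pd; rewrite ltnNge ltnW // d_f.
move: {da ar IH}(f a) => {}a.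
elim: {a}(d a).+1 {-2}a (ltnSn (d a)) => // {}n IH a da.
have [->|ar] := eqVneq a r; first by exists [::].
have [|p [pp up lr pd]] := IH (f a); first exact: leq_trans (d_f ar) da.
exists (f a :: p); split=> //.
- by rewrite /= tadj_tree_of_f.
- rewrite cons_uniq up andbT inE negb_or neq_f //=.
  by apply/negP => /pd; rewrite ltnNge ltnW // d_f.
- move=> z; rewrite inE => /orP[/eqP ->|/pd]; first exact: d_f.
  by move/ltn_trans; apply; apply: d_f.
Qed.

End Depth.

(** [d] is the distance to [r] in [T], and [f] picks a neighbour closer to [r]. *)
Lemma spanning_tree_exists_depth T : (forall x, connect (tadj T) x r) ->
  exists f (d : G -> nat), [/\ f r = r, forall x, x != r -> tadj T x (f x)
    & forall x, x != r -> d (f x) < d x].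
Proof.
move=> conn.
pose P x n := [exists p : n.-tuple G, path (tadj T) x p && (last x p == r)].
have ex x : exists n, P x n.
  case/connectP: (conn x) => p pp lr; exists (size p).
  by apply/existsP; exists (in_tuple p); rewrite pp -lr eqxx.
pose d x := ex_minn (ex x).
have step x : x != r -> exists y, tadj T x y && (d y < d x).
  move=> xr; rewrite {2}/d; case: ex_minnP => n /existsP[[[|y p] sp]] /=.
    by rewrite (negbTE xr).
  case/andP=> /andP[xy pp] lr _; exists y; rewrite xy /= /d -(eqP sp) ltnS.
  case: ex_minnP => n' _; apply; apply/existsP; exists (in_tuple p).
  by rewrite pp lr.
exists [ffun x => if [pick y | tadj T x y && (d y < d x)] is Some y
  then (if x == r then r else y) else r], d; split.
- by rewrite ffunE eqxx; case: pickP.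
- move=> x xr; rewrite ffunE (negbTE xr); case: pickP => [y /andP[] //|no].
  by have [y] := step _ xr; rewrite no.
- move=> x xr; rewrite ffunE (negbTE xr); case: pickP => [y /andP[] //|no].
  by have [y] := step _ xr; rewrite no.
Qed.

(** The parent edges already form a spanning tree inside [T]; a further edge of [T] would close a
    cycle with the tree path between its ends. *)
Lemma spanning_tree_eq_tree_of T : spanning_tree T ->
  exists f, intree (@adj G) r f /\ T = tree_of f.
Proof.
case=> Tsub Tconn Tac.
have [f [d [fr Tf df]]] := spanning_tree_exists_depth (fun x => Tconn x r).
have Tadj x y : tadj T x y -> adj x y.
  case/andP=> xy /(subsetP Tsub)/imset2P[a b _ adj_ab xyE].
  have {adj_ab} ab : adj a b := adj_ab.
  have := set21 x y; have := set22 x y; rewrite xyE !inE.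
  move=> /orP[] /eqP yE /orP[] /eqP xE; subst x y => //.
  - by rewrite eqxx in xy.
  - by rewrite adj_sym.
  - by rewrite eqxx in xy.
have adj_f x : x != r -> adj x (f x) by move=> xr; apply/Tadj/Tf.
exists f; split.
  apply/and3P; split; first exact/eqP.
    by apply/forallP => x; apply/implyP; apply: adj_f.
  exact/forallP/depth_fconnect/df.
have sub : tree_of f \subset T.
  by apply/subsetP => A /imsetP[x]; rewrite !inE => xr ->; case/andP: (Tf x xr).
apply/eqP; rewrite eqEsubset sub andbT; apply/subsetP => A AT.
have /imset2P[a b _ adj_ab AE] := subsetP Tsub _ AT; subst A.
have {adj_ab} ab : adj a b := adj_ab.
apply: contraT => nab.
have [_ conn _] := tree_of_spanning adj_f df.
have /connectP[p0 pp0 /esym lp0] := conn a b.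
case: (shortenP pp0) lp0 => p pp up _ lp.
have sub_path : path (tadj T) a p.
  by apply: sub_path pp => x y /andP[xy /(subsetP sub)]; rewrite /tadj xy.
have ba : tadj T b a.
  rewrite tadj_sym /tadj AT andbT.
  by apply: contraTneq ab => ->; rewrite adj_irr.
case: (Tac (a :: p)); last first.
  by apply/andP; split=> //; rewrite /= rcons_path sub_path lp ba.
(* The cycle has at least three vertices: an empty [p] would force [a = b], and a single step would
   put the edge in [tree_of f]. *)
case: p pp up lp {sub_path} => [|y [|z p]] //=.
  by move=> _ _ lp; rewrite lp adj_irr in ab.
by rewrite andbT => /andP[_ yin] _ yb; rewrite yb (negbTE nab) in yin.
Qed.

Lemma rooted_spanning_treeP D :
  rooted_spanning_tree r D <-> exists2 f, intree (@adj G) r f & D = arcs_of f.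
Proof.
split.
  case=> T [/spanning_tree_eq_tree_of[f [tf ->]] DE]; exists f => //.
  case/and3P: tf => _ /forallP adj_f /forallP/fconnect_depth[d df].
  apply/setP => -[a b]; apply/idP/idP.
    by move/DE; rewrite (oriented_tree_of _ df) // => x xr; apply: implyP (adj_f x) xr.
  move=> ab; apply/DE; rewrite (oriented_tree_of _ df) // => x xr.
  exact: implyP (adj_f x) xr.
case=> f /and3P[_ /forallP adj_f /forallP/fconnect_depth[d df]] ->.
have {}adj_f x : x != r -> adj x (f x) by exact: implyP (adj_f x).
exists (tree_of f); split; first exact: tree_of_spanning df.
by move=> a b; rewrite (oriented_tree_of _ df).
Qed.

End TreeOfFunction.

(** * Counting *)

Lemma eq_intree (T : finType) (w1 w2 : rel T) r : w1 =2 w2 ->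
  intree w1 r =1 intree w2 r.
Proof. by move=> w12 f; rewrite /intree; under eq_forallb do rewrite w12. Qed.

Lemma pinned_rev (T : finType) (adj : rel T) m (e1 t1 e2 t2 : nat -> T) :
  (forall k, k < m -> e1 k = e2 (m - k.+1)) ->
  (forall k, k < m -> t1 k = t2 (m - k.+1)) ->
  pinned adj m e1 t1 =2 pinned adj m e2 t2.
Proof.
move=> e12 t12 a b; rewrite /pinned; congr (_ && _).
apply/forallP/forallP => P k; have := P (rev_ord k); last by rewrite e12 ?t12.
rewrite e12 ?t12 ?ltn_ord //=.
have -> : m - (m - k.+1).+1 = k by have := ltn_ord k; lia.
by [].
Qed.

Lemma pinned_intree_card (T : finType) (adj : rel T) m (o e : nat -> T) :
  symmetric adj ->
  (forall j k, j < m -> k < m -> e j = e k -> j = k) ->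
  (forall j k, j < m -> k <= m -> e j != o k) ->
  (forall k, k < m -> o k != o k.+1) ->
  (forall k, k < m -> forall b, adj (e k) b = (b == o k) || (b == o k.+1)) ->
  #|[set f | intree (pinned adj m e (o \o S)) (o m) f]| =
  #|[set f | intree (pinned adj m e o) (o 0) f]|.
Proof.
move=> adjC e_inj eo oo adj_e; apply/eqP; rewrite eqn_dvd andbC.
rewrite pinned_intree_card_dvd //=.
(* There are [m] pinned vertices but [m + 1] vertices [o k], hence the different shifts. The
   reversal swaps the two roots and the two choices of targets. *)
pose e' k := e (m - k.+1); pose o' k := o (m - k).
have rev_lt k : k < m -> m - k.+1 < m by lia.
have rev_S k : k < m -> (m - k.+1).+1 = m - k by lia.
have := @pinned_intree_card_dvd T adj m o' e' adjC.
have <- : #|[set f | intree (pinned adj m e (o \o S)) (o m) f]| =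
          #|[set f | intree (pinned adj m e' o') (o' 0) f]|.
  apply: eq_card => f; rewrite !inE /o' subn0; apply: eq_intree.
  apply: pinned_rev => k km; rewrite /e' /o' /= ?rev_S //; congr (_ _); lia.
have <- : #|[set f | intree (pinned adj m e o) (o 0) f]| =
          #|[set f | intree (pinned adj m e' (o' \o S)) (o' m) f]|.
  apply: eq_card => f; rewrite !inE /o' subnn; apply: eq_intree.
  apply: pinned_rev => k km; rewrite /e' /o' /=; congr (_ _); lia.
apply.
- by move=> j k jm km /e_inj; rewrite !rev_lt // => /(_ isT isT); lia.
- by move=> j k jm km; apply: eo; [exact: rev_lt | exact: leq_subr].
- by move=> k km; rewrite eq_sym /o' -(rev_S k) // oo ?rev_lt.
- by move=> k km b; rewrite /e' adj_e ?rev_lt // orbC rev_S.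
Qed.

(** * From equal counts to a bijection *)

Lemma set_bij_finset (T : finType) (A B : {set T}) : #|A| = #|B| ->
  exists f : T -> T, set_bij [set` A]%classic [set` B]%classic f.
Proof.
(* Elements of equal rank in the two enumerations are matched; for [x] in [A] the index is in range,
   so the default is never returned. *)
move=> AB; exists (fun x => nth x (enum B) (index x (enum A))).
have lt x : x \in A -> index x (enum A) < size (enum B).
  by move=> xA; rewrite -cardE -AB cardE index_mem mem_enum.
split.
- by move=> x xA /=; rewrite -mem_enum mem_nth // lt.
- move=> x y /set_mem /= xA /set_mem /= yA /eqP.
  rewrite (set_nth_default x y) ?lt // nth_uniq ?enum_uniq ?lt // => /eqP.
  by move=> ii; apply: (index_inj x _ _ ii); rewrite mem_enum.
- move=> y /= yB; have iy : index y (enum B) < size (enum A).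
    by rewrite -cardE AB cardE index_mem mem_enum.
  exists (nth y (enum A) (index y (enum B))); first by rewrite /= -mem_enum mem_nth.
  rewrite index_uniq ?enum_uniq //; set x := nth y (enum A) _.
  by rewrite (set_nth_default y) ?nth_index // ?mem_enum // index_mem mem_enum.
Qed.

(** Containing the arc from [e k] to [t k] means that the parent of [e k] is [t k], as [e k] is not
    the root. *)
Lemma pinned_rooted_treesE (G : sgraph) m (e t : nat -> G) (r : G) :
  (forall k, k < m -> e k != r) ->
  [set D | rooted_spanning_tree r D /\ forall k, k < m -> (e k, t k) \in D]%classic =
  [set` arcs_of r @: [set f | intree (pinned (@adj G) m e t) r f]%SET]%classic.
Proof.
move=> er; apply/seteqP; split=> D /=.
  case=> /rooted_spanning_treeP[f /and3P[fr /forallP af conn] ->] et.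
  apply: imset_f; rewrite inE /intree fr conn andbT /=.
  apply/forallP => x; apply/implyP => xr.
  rewrite /pinned (implyP (af x) xr); apply/forallP => k; apply/implyP => /eqP ->.
  by have := et k (ltn_ord k); rewrite arcs_ofE er //= eq_sym.
case/imsetP => f; rewrite inE => /and3P[fr /forallP pf conn] ->.
have {}pf x : x != r -> pinned (@adj G) m e t x (f x) by exact: implyP (pf x).
split=> [|k km].
  apply/rooted_spanning_treeP; exists f => //; rewrite /intree fr conn andbT.
  by apply/forallP => x; apply/implyP => /pf /andP[].
rewrite arcs_ofE er //=; case/andP: (pf (e k) (er k km)) => _.
by move/forallP/(_ (Ordinal km)); rewrite eqxx eq_sym.
Qed.

Lemma card_arcs_of (G : sgraph) (w : rel G) (r : G) :
  #|arcs_of r @: [set f | intree w r f]| = #|[set f | intree w r f]|.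
Proof.
rewrite card_in_imset // => f g; rewrite !inE => /and3P[/eqP fr _ _] /and3P[/eqP gr _ _].
exact: arcs_of_inj.
Qed.

Theorem theorem2p3 (R : realType) (G : plane_graph R) (F : set (R * R))
    (n : nat) (v : nat -> G) :
  0 < n ->
  unbounded_face G F ->
  is_path v (2 * n - 1) ->
  path_on_boundary F v (2 * n - 1) ->
  (forall k, 0 < k < n -> degree (v (2 * k)) = 2) ->
  exists f : {set G * G} -> {set G * G},
    set_bij
      [set D | rooted_spanning_tree (v (2 * n - 1)) D /\
         forall k, 0 < k < n -> (v (2 * k), v (2 * k + 1)) \in D]%classic
      [set D | rooted_spanning_tree (v 1) D /\
         forall k, 0 < k < n -> (v (2 * k), v (2 * k - 1)) \in D]%classic
      f.
Proof.
case: n => // m _ _ [v_adj v_inj] _ deg.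
(* With [n = m.+1], the vertices [o 0], ..., [o m] run from [v 1] to [v (2 * n - 1)], and [e k] with
   [k < m] lies between [o k] and [o k.+1]. *)
pose o k := v (2 * k + 1); pose e k := v (2 * k.+1).
have rE : v (2 * m.+1 - 1) = o m by congr v; lia.
have range (P : nat -> Prop) :
    (forall k, 0 < k < m.+1 -> P k) <-> (forall k, k < m -> P k.+1).
  by split=> [Pk k km|Pk [|k] // km]; apply: Pk.
have oS k : o k = v (2 * k.+1 - 1) by congr v; lia.
have eo j k : j < m -> k <= m -> e j != o k.
  by move=> jm km; apply/eqP => /v_inj; lia.
have oo k : k < m -> o k != o k.+1.
  by move=> km; apply/eqP => /v_inj; lia.
have e_inj j k : j < m -> k < m -> e j = e k -> j = k.
  by move=> jm km /v_inj; lia.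
have adj_e k : k < m -> forall b, adj (e k) b = (b == o k) || (b == o k.+1).
  move=> km.
  have adj_o : adj (e k) (o k).
    have -> : e k = v (2 * k + 1).+1 by congr v; lia.
    by rewrite adj_sym v_adj //; lia.
  have adj_oS : adj (e k) (o k.+1) by rewrite /o addn1 v_adj //; lia.
  (* The two path neighbours of [e k] are distinct, so degree two leaves no other neighbour. *)
  have sub : {subset pred2 (o k) (o k.+1) <= adj (e k)} by move=> b /pred2P[]->.
  have := subset_cardP _ (introT fintype.subsetP sub).
  rewrite card2 oo // -/(degree (e k)) deg ?ltnS ?km // => /(_ erefl) adjE b.
  by rewrite -[LHS]adjE.
have card := pinned_intree_card (@adj_sym G) e_inj eo oo adj_e.
rewrite rE.
have -> : [set D | rooted_spanning_tree (o m) D /\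
         forall k, 0 < k < m.+1 -> (v (2 * k), v (2 * k + 1)) \in D]%classic =
   [set D | rooted_spanning_tree (o m) D /\
         forall k, k < m -> (e k, (o \o S) k) \in D]%classic.
  apply/seteqP; split=> D [DT] De; split=> //;
    exact/(range (fun k => (v (2 * k), v (2 * k + 1)) \in D)).
have -> : [set D | rooted_spanning_tree (v 1) D /\
         forall k, 0 < k < m.+1 -> (v (2 * k), v (2 * k - 1)) \in D]%classic =
   [set D | rooted_spanning_tree (o 0) D /\
         forall k, k < m -> (e k, o k) \in D]%classic.
  apply/seteqP; split=> D [DT] De; split=> //.
    by move=> k km; rewrite oS De.
  by apply/(range (fun k => _ \in D)) => k km; rewrite -oS De.
rewrite !pinned_rooted_treesE; try by move=> k km; apply: eo.
by apply: set_bij_finset; rewrite !card_arcs_of.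
Qed.
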